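(* Let $n\ge 2$, let $p\in(0,1)$, and let $k\in\{1,\ldots,n\}$. Let $\overline{P}(n,k,p)$ be the tightest upper bound on the probability that $n$ pairwise independent identical Bernoulli random variables with success probability $p$ add up to at least $k$. Then $$\overline{P}(n,k,p)=\begin{cases}1, & k<(n-1)p,\\[1mm] \dfrac{((n-1)(1-p)+k)\,p}{k}, & (n-1)p\le k<1+(n-1)p,\\[2mm] \dfrac{(i-1)(i-2np)+n(n-1)p^2}{(k-i)^2+(k-i)}, & k\ge 1+(n-1)p,\end{cases}$$ where $i=\left\lceil\dfrac{np\,(k-1-(n-1)p)}{k-np}\right\rceil$.
   Context: $\overline{P}(n,k,p)$ denotes the maximum of $\mathbb{P}_\theta\left(\sum_{i=1}^n\tilde c_i\ge k\right)$ over all probability distributions $\theta$ of a random vector $(\tilde c_1,\ldots,\tilde c_n)$ on $\{0,1\}^n$ satisfying $\mathbb{P}_\theta(\tilde c_i=1)=p$ for all $1\le i\le n$ and $\mathbb{P}_\theta(\tilde c_i=1,\tilde c_j=1)=p^2$ for all $1\le i<j\le n$. $\lceil x\rceil$ is the smallest integer $\ge x$. *)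

(* Defs.v *)
From mathcomp Require Import all_boot all_order all_algebra.
From mathcomp Require Import all_classical all_reals all_analysis.

Set Implicit Arguments.
Unset Strict Implicit.
Unset Printing Implicit Defensive.

Import Order.TTheory GRing.Theory Num.Theory.

Local Open Scope classical_set_scope.
Local Open Scope ring_scope.

(* A vector in {0,1}^n is an n.-tuple bool.  Its library sigma-algebra is the
   product of the discrete ones, hence every set of vectors is measurable. *)
Definition pairwise_independent_bernoulli (R : realType) (n : nat) (p : R)
    (theta : probability (n.-tuple bool) R) : Prop :=
  (forall i : 'I_n, theta [set c | tnth c i = true] = p%:E) /\
  (forall i j : 'I_n, (i < j)%N ->
     theta [set c | tnth c i = true /\ tnth c j = true] = (p ^+ 2)%:E).

(* [tnth c i : bool] is read as 0 or 1 through the coercion from bool to nat. *)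
Definition sum_at_least (n k : nat) : set (n.-tuple bool) :=
  [set c : n.-tuple bool | (k <= \sum_(i < n) tnth c i)%N].
Arguments sum_at_least : clear implicits.

Definition tail_probabilities (R : realType) (n k : nat) (p : R) :
    set (\bar R) :=
  [set theta (sum_at_least n k) |
     theta in [set theta : probability (n.-tuple bool) R |
                 pairwise_independent_bernoulli p theta]].

(* Defined as a supremum; it is a maximum exactly when it belongs to
   [tail_probabilities n k p]. *)
Definition Pbar (R : realType) (n k : nat) (p : R) : \bar R :=
  ereal_sup (tail_probabilities n k p).

(* Main.v *)
Require Import Defs.
From mathcomp Require Import all_boot all_order all_algebra.
From mathcomp Require Import fingroup perm.
From mathcomp Require Import all_classical all_reals all_analysis.
From mathcomp Require Import zify ring lra.
Set Implicit Arguments.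
Unset Strict Implicit.
Unset Printing Implicit Defensive.
Import Order.TTheory GRing.Theory Num.Theory.
Local Open Scope ring_scope.

(** Let S be the number of ones.  The prescribed marginals and pair
    probabilities fix E[S] = n p and E[S (S - 1)] = n (n - 1) p^2, hence the mean
    of every quadratic polynomial in S ([expectation_sum]).  Conversely, every
    law on {0, ..., n} with these two moments is the law of S for some admissible
    vector: draw s from that law and put s ones at uniformly random places
    ([tail_of_sum_law]).  So the value sought is that of a linear program over
    the laws of S with three equality constraints, and it is found by linear
    programming duality.

    A quadratic polynomial g that dominates the indicator of [k, n] on
    {0, ..., n} gives the upper bound E[g(S)] ([tail_le_quadratic]).  The bound is
    attained by any law with the right moments carried by points where g equals
    the indicator.  On three points a < b < c the weights are forced by Lagrange
    interpolation: up to positive factors they are E[(S - b)(S - c)], the opposite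
    of E[(S - a)(S - c)], and E[(S - a)(S - b)], so only the signs of these three
    numbers have to be checked ([Pbar_quadratic]).  The optimal pairs are

    - for k < (n - 1) p: g = 1 and the points a, a + 1, n, where a is the integer
      part of (n - 1) p;
    - for (n - 1) p <= k <= 1 + (n - 1) p: g(s) = 1 - (s - k)(s - n) / (k n) and
      the points 0, k, n;
    - for k >= 1 + (n - 1) p:
      g(s) = (s - i + 1)(s - i) / ((k - i + 1)(k - i)) and the points i - 1, i, k,
      the rounding i being exactly what makes the weights of i - 1 and i
      nonnegative; if i = 0 then k = 1 + (n - 1) p and the previous case applies.

    The remaining sign condition E[(S - i + 1)(S - i)] >= 0 for integers i is
    [mean_quadratic_consecutive_ge0]. *)

(** * Probabilities on Boolean vectors *)

Lemma finite_mixture (R : realType) (d : measure_display) (T : measurableType d)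
    (I : finType) (w : I -> R) (x : I -> T) :
  (forall i, 0 <= w i) -> \sum_i w i = 1 ->
  exists P : probability T R,
    forall A : set T, P A = (\sum_i w i * (x i \in A)%:R)%:E.
Proof.
move=> w0 w1.
have [i0 _] : exists i0 : I, true.
  apply/existsP; apply: contra_eqT w1 => /existsPn noI.
  by rewrite big1 ?[0 == 1]eq_sym ?oner_neq0// => i; have := noI i.
pose y k := nth i0 (enum I) k.
pose mk k : {measure set T -> \bar R} :=
  mscale (NngNum (w0 (y k))) (dirac (x (y k))).
have [mu muE] : exists mu : {measure set T -> \bar R},
    forall A, mu A = (\sum_i w i * (x i \in A)%:R)%:E.
  exists (msum mk #|I|) => A.
  rewrite /= /msum -sumEFin -(big_mkord xpredT (fun k => mk k A)) /=.
  rewrite -[RHS]big_enum /= (big_nth i0) -cardE.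
  by apply: eq_bigr => k _; rewrite /mk /= /mscale /= diracE -EFinM.
have mu1 : mu setT = 1%E.
  by rewrite muE; under eq_bigr do rewrite in_setT mulr1; rewrite w1.
(* The total mass is 1, so normalization changes nothing; it only supplies the
   probability structure. *)
exists (mnormalize mu (dirac (x i0))) => A.
by rewrite /= /mnormalize mu1 /= onee_eq0 /= invr1 mule1 muE.
Qed.

Lemma measurable_tuple_bool n (A : set (n.-tuple bool)) : measurable A.
Proof.
have -> : A = (\bigcup_(c in A) [set c])%classic.
  by apply/seteqP; split=> [c Ac|c [c' Ac' ->]//]; exists c.
apply: fin_bigcup_measurable => [|c _]; first exact: finite_finset.
have -> : [set c]%classic =
    (\bigcap_(i in [set: 'I_n])
      ((fun c' => tnth c' i) @^-1` [set tnth c i]))%classic.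
  apply/seteqP; split=> [_ -> //|c' cc'].
  by apply: eq_from_tnth => i; exact: cc'.
apply: fin_bigcap_measurable => [|i _]; first exact: finite_finset.
by rewrite -[X in measurable X]setTI; exact: measurable_tnth.
Qed.

Lemma probability_tuple_bool (R : realType) n
    (theta : probability (n.-tuple bool) R) (A : set (n.-tuple bool)) :
  theta A = (\sum_c fine (theta [set c]%classic) * (c \in A)%:R)%:E.
Proof.
have {1}-> : A = (\bigcup_(c in A) [set c])%classic.
  by apply/seteqP; split=> [c Ac|c [c' Ac' ->]//]; exists c.
rewrite measure_fin_bigcup; last first.
- by move=> c _; exact: measurable_tuple_bool.
- by move=> c c' _ _ [d [-> ->]].
- exact: finite_finset.
rewrite -[X in \sum_(i \in X) _]set_mem_set
  -(@bigfs _ _ _ _ (enum {: n.-tuple bool})).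
- rewrite big_enum_cond /= -sumEFin big_mkcond /=; apply: eq_bigr => c _.
  change (in_set A c) with (c \in A); case: (c \in A); last by rewrite mulr0n mulr0.
  by rewrite mulr1n mulr1 fineK// fin_num_measure//; exact: measurable_tuple_bool.
- exact: enum_uniq.
- by move=> c _; rewrite mem_enum.
Qed.

(** * Moments of the number of ones *)

Lemma sum_bool_falling (R : realType) n (b : 'I_n -> bool) :
  (\sum_(i < n) b i)%N%:R * ((\sum_(i < n) b i)%N%:R - 1) =
  \sum_i \sum_(j | j != i) (b i && b j)%:R :> R.
Proof.
rewrite natr_sum mulrBr mulr1 mulr_suml -sumrB; apply: eq_bigr => i _.
rewrite mulr_sumr (bigD1 i)//= -natrM mulnb andbb addrC addrK.
by apply: eq_bigr => j _; rewrite -natrM mulnb.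
Qed.

Lemma sum_pairs_const (R : realType) n (x : R) :
  \sum_(i < n) \sum_(j < n | j != i) x = n%:R * (n%:R - 1) * x.
Proof.
under eq_bigr => i _.
  have -> : \sum_(j < n | j != i) x = n%:R * x - x.
    have : \sum_(j < n) x = x + \sum_(j < n | j != i) x by rewrite (bigD1 i).
    by rewrite sumr_const card_ord mulr_natl => ->; rewrite addrC addKr.
  over.
rewrite sumr_const card_ord -[LHS]mulr_natl; ring.
Qed.

Lemma sum_ltn_ord n v : (v <= n)%N -> (\sum_(i < n) (i < v) = v)%N.
Proof.
have H : (\sum_(i < n) (i < v) = minn n v)%N.
  elim: n => [|n IH]; first by rewrite big_ord0 min0n.
  by rewrite big_ord_recr/= IH; lia.
by rewrite H => /minn_idPr.
Qed.

Lemma sum_perm_ltn n v (s : 'S_n) : (v <= n)%N -> (\sum_(i < n) (s i < v) = v)%N.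
Proof.
move=> vn; rewrite -[RHS](sum_ltn_ord vn) [RHS](reindex_inj (@perm_inj _ s)).
by [].
Qed.

(** By symmetry the sum over permutations is the same for all coordinates, and
    exactly v coordinates have an image below v. *)
Lemma sum_perm_coord (R : realType) n v (i : 'I_n) : (v <= n)%N ->
  n%:R * \sum_(s : 'S_n) (s i < v)%N%:R = n`!%:R * v%:R :> R.
Proof.
move=> vn; transitivity (\sum_(i' < n) \sum_(s : 'S_n) (s i' < v)%N%:R : R).
  rewrite -{1}[n]card_ord mulr_natl -sumr_const; apply: eq_bigr => i' _.
  rewrite (reindex_inj (mulgI (tperm i' i))); apply: eq_bigr => s _.
  by rewrite permM tpermR.
rewrite exchange_big/=; under eq_bigr do rewrite -natr_sum sum_perm_ltn//.
by rewrite sumr_const -cardsE cardsT card_Sn mulr_natl.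
Qed.

(** The analogue for pairs uses the double transitivity of the symmetric
    group. *)
Lemma sum_perm_coord_pair (R : realType) n v (i j : 'I_n) : (v <= n)%N -> i != j ->
  n%:R * (n%:R - 1) * \sum_(s : 'S_n) ((s i < v) && (s j < v))%N%:R =
  n`!%:R * (v%:R * (v%:R - 1)) :> R.
Proof.
move=> vn ij.
transitivity (\sum_(i' < n) \sum_(j' < n | j' != i')
    \sum_(s : 'S_n) ((s i' < v) && (s j' < v))%N%:R : R).
  rewrite -sum_pairs_const; apply: eq_bigr => i' _; apply: eq_bigr => j' j'i'.
  pose t := (tperm i' i * tperm (tperm i' i j') j)%g.
  have ti : t i' = i.
    rewrite permM tpermL tpermD//; last by rewrite eq_sym.
    by rewrite -{2}(tpermL i' i) (inj_eq perm_inj).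
  have tj : t j' = j by rewrite permM tpermL.
  clearbody t; rewrite [RHS](reindex_inj (mulgI t)); apply: eq_bigr => s _.
  by rewrite !permM ti tj.
under eq_bigr do rewrite exchange_big/=.
rewrite exchange_big/=; under eq_bigr => s _.
  rewrite -sum_bool_falling sum_perm_ltn//.
  over.
by rewrite sumr_const -cardsE cardsT card_Sn [RHS]mulr_natl.
Qed.

(** A law of S is given as a mixture over a finite type J of point masses at the
    values v, which need not be distinct. *)
Lemma tail_of_sum_law (R : realType) n k (p : R) (J : finType) (q : J -> R)
    (v : J -> nat) :
  (2 <= n)%N -> (forall j, 0 <= q j) -> (forall j, v j <= n)%N ->
  \sum_j q j = 1 -> \sum_j q j * (v j)%:R = n%:R * p ->
  \sum_j q j * ((v j)%:R * ((v j)%:R - 1)) = n%:R * (n%:R - 1) * p ^+ 2 ->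
  tail_probabilities n k p (\sum_j q j * (k <= v j)%N%:R)%:E.
Proof.
move=> n2 q0 vn q1 qv qvv.
have n0 : n%:R != 0 :> R by rewrite pnatr_eq0; lia.
have n10 : n%:R - 1 != 0 :> R by rewrite subr_eq0 (eqr_nat R n 1); lia.
have nf0 : n`!%:R != 0 :> R by rewrite pnatr_eq0 -lt0n fact_gt0.
(* Mixture over pairs (j, s) of the vector with ones at the coordinates that s
   sends below v j. *)
pose w (a : J * 'S_n) := q a.1 / n`!%:R.
pose x (a : J * 'S_n) := [tuple (a.2 i < v a.1)%N | i < n].
have sumw (F : J * 'S_n -> R) :
    \sum_a w a * F a = \sum_j q j / n`!%:R * \sum_(s : 'S_n) F (j, s).
  under [RHS]eq_bigr do rewrite mulr_sumr.
  by rewrite pair_bigA/=; apply: eq_bigr => -[].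
have sumw_cst (f : J -> R) : \sum_a w a * f a.1 = \sum_j q j * f j.
  rewrite (sumw (fun a => f a.1)); apply: eq_bigr => j _ /=.
  rewrite sumr_const -cardsE cardsT card_Sn -[f j *+ _]mulr_natl; field.
  exact: nf0.
have [a||theta thetaE] :=
  @finite_mixture R _ (n.-tuple bool : measurableType _) _ w x.
- by rewrite /w divr_ge0.
- have := sumw_cst (fun=> 1); under eq_bigr do rewrite mulr1.
  by move=> ->; under eq_bigr do rewrite mulr1.
exists theta; last first.
  rewrite thetaE -(sumw_cst (fun j => (k <= v j)%N%:R)); congr _%:E.
  apply: eq_bigr => -[j s] _; congr (_ * (nat_of_bool _)%:R).
  have E : (\sum_(i < n) tnth (x (j, s)) i)%N = v j.
    by under eq_bigr do rewrite tnth_mktuple; exact: sum_perm_ltn.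
  by apply/idP/idP; rewrite inE /sum_at_least /= E.
split=> [i|i j ij].
- rewrite thetaE; congr _%:E; apply: (mulfI n0); rewrite -qv.
  rewrite mulr_sumr [LHS](_ : _ = n%:R * \sum_a w a * (a.2 i < v a.1)%N%:R).
    rewrite sumw mulr_sumr; apply: eq_bigr => j _ /=.
    by rewrite mulrCA sum_perm_coord// mulrA divfK.
  rewrite -mulr_sumr; congr (_ * _); apply: eq_bigr => a _; congr (_ * (nat_of_bool _)%:R).
  by apply/idP/idP; rewrite inE /= tnth_mktuple.
- rewrite thetaE; congr _%:E; apply: (mulfI (mulf_neq0 n0 n10)); rewrite -qvv.
  rewrite [X in _ * X](_ : _ =
    \sum_a w a * ((a.2 i < v a.1) && (a.2 j < v a.1))%N%:R); last first.
    apply: eq_bigr => a _; congr (_ * (nat_of_bool _)%:R).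
    by apply/idP/idP; rewrite inE /= !tnth_mktuple => /andP.
  rewrite sumw mulr_sumr; apply: eq_bigr => l _ /=.
  rewrite mulrCA sum_perm_coord_pair// ?mulrA ?divfK//.
  by apply: contraTneq ij => ->; rewrite ltnn.
Qed.

Lemma expectation_sum (R : realType) n (p : R)
    (theta : probability (n.-tuple bool) R) (a b c : R) :
  pairwise_independent_bernoulli p theta ->
  \sum_x fine (theta [set x]%classic) *
    (a + b * (\sum_(i < n) tnth x i)%N%:R
       + c * ((\sum_(i < n) tnth x i)%N%:R * ((\sum_(i < n) tnth x i)%N%:R - 1)))
  = a + b * (n%:R * p) + c * (n%:R * (n%:R - 1) * p ^+ 2).
Proof.
move=> [H1 H2].
set m := fun x => fine (theta [set x]%classic).
have E0 : \sum_x m x = 1.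
  have := probability_setT theta; rewrite probability_tuple_bool => -[<-].
  by apply: eq_bigr => x _; rewrite in_setT mulr1.
have E1 i : \sum_x m x * (tnth x i)%:R = p.
  have := H1 i; rewrite probability_tuple_bool => -[<-].
  apply: eq_bigr => x _; congr (_ * (nat_of_bool _)%:R).
  by apply/idP/idP; rewrite inE.
have E2 i j : j != i -> \sum_x m x * (tnth x i && tnth x j)%:R = p ^+ 2.
  move=> ji.
  have lt (i' j' : 'I_n) : (i' < j')%N ->
      \sum_x m x * (tnth x i' && tnth x j')%:R = p ^+ 2.
    move=> /H2; rewrite probability_tuple_bool => -[<-].
    apply: eq_bigr => x _; congr (_ * (nat_of_bool _)%:R).
    by apply/idP/idP; rewrite inE /= => /andP.
  case: (ltngtP i j) => [/lt//|/lt <-|/val_inj ij]; last by rewrite ij eqxx in ji.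
  by apply: eq_bigr => x _; rewrite andbC.
under eq_bigr do rewrite 2!(mulrDr (m _)).
rewrite !big_split /=; congr (_ + _ + _).
- by rewrite -mulr_suml E0 mul1r.
- under eq_bigr do rewrite mulrCA natr_sum mulr_sumr.
  rewrite -mulr_sumr exchange_big/=; under eq_bigr do rewrite E1.
  by rewrite sumr_const card_ord mulr_natl.
- under eq_bigr => x _ do rewrite mulrCA (sum_bool_falling R (tnth x)) mulr_sumr.
  rewrite -mulr_sumr exchange_big/= -sum_pairs_const; congr (_ * _).
  apply: eq_bigr => i _; under eq_bigr do rewrite mulr_sumr.
  by rewrite exchange_big/=; apply: eq_bigr => j /E2.
Qed.

(** * Duality with quadratic polynomials *)

(** The common value of E[(S - u)(S - t)], computed from
    (s - u)(s - t) = s (s - 1) + (1 - u - t) s + u t. *)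
Definition mean_quadratic (R : realType) (n : nat) (p u t : R) : R :=
  n%:R * (n%:R - 1) * p ^+ 2 + (1 - u - t) * (n%:R * p) + u * t.

Lemma tail_le_quadratic (R : realType) n k (p e f u t : R) :
  (forall s : nat, (s <= n)%N ->
    (k <= s)%N%:R <= e + f * ((s%:R - u) * (s%:R - t))) ->
  ubound (tail_probabilities n k p) (e + f * mean_quadratic n p u t)%:E.
Proof.
move=> f_ge _ [theta Htheta <-].
have -> : e + f * mean_quadratic n p u t = (e + f * (u * t)) +
    f * (1 - u - t) * (n%:R * p) + f * (n%:R * (n%:R - 1) * p ^+ 2).
  by rewrite /mean_quadratic; ring.
rewrite -(expectation_sum _ _ _ Htheta) probability_tuple_bool lee_fin.
apply: ler_sum => x _; apply: ler_wpM2l; first exact: fine_ge0.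
have -> : (x \in sum_at_least n k) = (k <= \sum_(i < n) tnth x i)%N.
  by apply/idP/idP; rewrite inE.
set s := (\sum_(i < n) tnth x i)%N.
have sn : (s <= n)%N.
  rewrite -[leqRHS]card_ord -sum1_card.
  by apply: leq_sum => i _; exact: leq_b1.
apply: le_trans (f_ge _ sn) _; rewrite le_eqVlt; apply/orP; left; apply/eqP; ring.
Qed.

Lemma three_point_tail (R : realType) n k (p : R) (a b c : nat) (wa wb wc : R) :
  (2 <= n)%N -> (a <= n)%N -> (b <= n)%N -> (c <= n)%N ->
  0 <= wa -> 0 <= wb -> 0 <= wc ->
  wa + wb + wc = 1 -> wa * a%:R + wb * b%:R + wc * c%:R = n%:R * p ->
  wa * (a%:R * (a%:R - 1)) + wb * (b%:R * (b%:R - 1)) + wc * (c%:R * (c%:R - 1))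
    = n%:R * (n%:R - 1) * p ^+ 2 ->
  tail_probabilities n k p
    (wa * (k <= a)%N%:R + wb * (k <= b)%N%:R + wc * (k <= c)%N%:R)%:E.
Proof.
move=> n2 an bn cn wa0 wb0 wc0 m0 m1 m2.
have sum3 (F : R -> nat -> R) :
    \sum_(j < 3) F (tnth [tuple wa; wb; wc] j) (tnth [tuple a; b; c] j) =
    F wa a + F wb b + F wc c.
  by rewrite !big_ord_recl big_ord0 addr0 addrA !(tnth_nth wa, tnth_nth a).
rewrite -(sum3 (fun w s => w * (k <= s)%N%:R)).
apply: tail_of_sum_law => //.
- by move=> j; case/tnthP: (mem_tnth j [tuple wa; wb; wc]) => i ->; 
     case: i => -[|[|[|//]]] ?; rewrite (tnth_nth wa).
- by case=> -[|[|[|//]]] ?; rewrite (tnth_nth a).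
- by rewrite (sum3 (fun w _ => w)).
- by rewrite (sum3 (fun w s => w * s%:R)).
- by rewrite (sum3 (fun w s => w * (s%:R * (s%:R - 1)))).
Qed.

(** Complementary slackness: a quadratic polynomial that dominates the indicator
    of [k, n] and equals it at the points a < b < c is optimal as soon as the
    interpolation weights of these points are nonnegative. *)
Lemma Pbar_quadratic (R : realType) n k (p e f u t : R) (a b c : nat) :
  (2 <= n)%N -> (a < b)%N -> (b < c)%N -> (c <= n)%N ->
  0 <= mean_quadratic n p b%:R c%:R -> mean_quadratic n p a%:R c%:R <= 0 ->
  0 <= mean_quadratic n p a%:R b%:R ->
  (forall s : nat, (s <= n)%N ->
    (k <= s)%N%:R <= e + f * ((s%:R - u) * (s%:R - t))) ->
  (forall s, s \in [:: a; b; c] ->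
    (k <= s)%N%:R = e + f * ((s%:R - u) * (s%:R - t))) ->
  tail_probabilities n k p (Pbar n k p) /\
  Pbar n k p = (e + f * mean_quadratic n p u t)%:E.
Proof.
move=> n2 ab bc cn Gbc Gac Gab major touch.
suff tail_v : tail_probabilities n k p (e + f * mean_quadratic n p u t)%:E.
  have -> : Pbar n k p = (e + f * mean_quadratic n p u t)%:E.
    apply/eqP; rewrite eq_le; apply/andP; split.
      exact/ge_ereal_sup/tail_le_quadratic.
    exact: ereal_sup_ubound.
  by [].
have ba0 : 0 < b%:R - a%:R :> R by rewrite subr_gt0 ltr_nat.
have cb0 : 0 < c%:R - b%:R :> R by rewrite subr_gt0 ltr_nat.
have ca0 : 0 < c%:R - a%:R :> R by rewrite subr_gt0 ltr_nat (ltn_trans ab).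
pose wa := mean_quadratic n p b%:R c%:R / ((b%:R - a%:R) * (c%:R - a%:R)).
pose wb := - mean_quadratic n p a%:R c%:R / ((b%:R - a%:R) * (c%:R - b%:R)).
pose wc := mean_quadratic n p a%:R b%:R / ((c%:R - a%:R) * (c%:R - b%:R)).
have nz : [/\ b%:R - a%:R != 0 :> R, c%:R - b%:R != 0 :> R & c%:R - a%:R != 0 :> R].
  by split; rewrite gt_eqF.
have [ba cb ca] := nz.
have m0 : wa + wb + wc = 1.
  by rewrite /wa /wb /wc /mean_quadratic; field; rewrite ba cb ca.
have m1 : wa * a%:R + wb * b%:R + wc * c%:R = n%:R * p.
  by rewrite /wa /wb /wc /mean_quadratic; field; rewrite ba cb ca.
have m2 : wa * (a%:R * (a%:R - 1)) + wb * (b%:R * (b%:R - 1)) +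
    wc * (c%:R * (c%:R - 1)) = n%:R * (n%:R - 1) * p ^+ 2.
  by rewrite /wa /wb /wc /mean_quadratic; field; rewrite ba cb ca.
have -> : e + f * mean_quadratic n p u t =
    wa * (k <= a)%N%:R + wb * (k <= b)%N%:R + wc * (k <= c)%N%:R.
  rewrite !touch ?inE ?eqxx ?orbT// /mean_quadratic -m2 -m1.
  rewrite -[in LHS](mulr1 (u * t)) -[in LHS](mulr1 e) -m0; ring.
apply: three_point_tail => //.
- by lia.
- by lia.
- by rewrite /wa divr_ge0// mulr_ge0// ltW.
- by rewrite /wb divr_ge0 ?oppr_ge0// mulr_ge0// ltW.
- by rewrite /wc divr_ge0// mulr_ge0// ltW.
Qed.

(** * The three regimes *)

Lemma mean_quadratic_top (R : realType) n (p t : R) :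
  mean_quadratic n p t n%:R = n%:R * (1 - p) * (t - (n%:R - 1) * p).
Proof. by rewrite /mean_quadratic; ring. Qed.

(** The bound holds for every real p: it does not rely on the existence of a
    vector with these moments, but on the integrality of i and on 1 <= i <= n. *)
Lemma mean_quadratic_consecutive_ge0 (R : realType) n (p : R) (i : nat) :
  (1 <= i <= n)%N -> 0 <= mean_quadratic n p (i%:R - 1) i%:R.
Proof.
move=> /andP[i1 iN].
have n0 : 0 < n%:R :> R by rewrite ltr0n (leq_trans i1).
have i1R : 0 <= i%:R - 1 :> R by rewrite subr_ge0 ler1n.
have inR : 0 <= n%:R - i%:R :> R by rewrite subr_ge0 ler_nat.
rewrite -(pmulr_rge0 _ n0).
(* Multiplied by n, the expression is a sum of products of n - i, i - 1 and
   squares. *)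
pose d := i%:R - n%:R * p.
have -> : n%:R * mean_quadratic n p (i%:R - 1) i%:R =
    (n%:R - i%:R) * (1 - d) ^+ 2 + (n%:R - i%:R) * (i%:R - 1) +
    d ^+ 2 * (i%:R - 1).
  by rewrite /mean_quadratic /d; ring.
by rewrite !addr_ge0// mulr_ge0// sqr_ge0.
Qed.

Lemma Pbar_small_k (R : realType) n k (p : R) :
  (2 <= n)%N -> 0 < p < 1 -> k%:R < (n%:R - 1) * p ->
  tail_probabilities n k p (Pbar n k p) /\ Pbar n k p = 1%:E.
Proof.
move=> n2 /andP[p0 p1] kp.
have n1 : 0 < n%:R - 1 :> R by rewrite subr_gt0 ltr1n.
have q0 : 0 <= 1 - p by rewrite subr_ge0 ltW.
pose a := Num.truncn ((n%:R - 1) * p).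
have /andP[a_le a_gt] : a%:R <= (n%:R - 1) * p < a.+1%:R.
  by apply: truncn_itv; rewrite mulr_ge0// ltW.
have ka : (k <= a)%N by rewrite -ltnS -(ltr_nat R); exact: lt_trans a_gt.
have an : (a.+1 < n)%N.
  rewrite -(ltr_nat R) -natr1 -ltrBrDr; apply: le_lt_trans a_le _.
  by rewrite gtr_pMr.
have -> : 1%:E = (1 + 0 * mean_quadratic n p 0 0)%:E by rewrite mul0r addr0.
apply: (@Pbar_quadratic _ _ _ _ _ _ _ _ a a.+1 n) => //.
- by rewrite mean_quadratic_top mulr_ge0 ?mulr_ge0// subr_ge0 ltW.
- by rewrite mean_quadratic_top mulr_ge0_le0 ?mulr_ge0// subr_le0.
- have := @mean_quadratic_consecutive_ge0 R n p a.+1.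
  by rewrite -{1}natr1 addrK; apply; exact: ltnW.
- by move=> s _; rewrite mul0r addr0 lern1 leq_b1.
- move=> s; rewrite !inE mul0r addr0 => sE.
  by have -> : (k <= s)%N by move: sE ka an; lia.
Qed.

(** Both ends of the range are included: at k = 1 + (n - 1) p the point n has
    weight 0. *)
Lemma Pbar_middle_k (R : realType) n k (p : R) :
  (2 <= n)%N -> 0 < p < 1 -> (1 <= k)%N ->
  (n%:R - 1) * p <= k%:R <= 1 + (n%:R - 1) * p ->
  tail_probabilities n k p (Pbar n k p) /\
  Pbar n k p = (((n%:R - 1) * (1 - p) + k%:R) * p / k%:R)%:E.
Proof.
move=> n2 /andP[p0 p1] k1 /andP[kge kle].
have n1 : 0 < n%:R - 1 :> R by rewrite subr_gt0 ltr1n.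
have q0 : 0 <= 1 - p by rewrite subr_ge0 ltW.
have k0 : 0 < k%:R :> R by rewrite ltr0n.
have n0 : 0 < n%:R :> R by rewrite ltr0n; lia.
have kn : (k < n)%N.
  rewrite -(ltr_nat R); apply: le_lt_trans kle _.
  by rewrite -ltrBrDl gtr_pMr.
have -> : ((n%:R - 1) * (1 - p) + k%:R) * p / k%:R =
    1 + - (k%:R * n%:R)^-1 * mean_quadratic n p k%:R n%:R.
  by rewrite mean_quadratic_top; field; rewrite !gt_eqF.
have touch0 : 1 + - (k%:R * n%:R)^-1 * ((0 - k%:R) * (0 - n%:R)) = 0 :> R.
  by field; rewrite !gt_eqF.
apply: (@Pbar_quadratic _ _ _ _ _ _ _ _ 0 k n) => //.
- by rewrite mean_quadratic_top mulr_ge0 ?mulr_ge0// subr_ge0.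
- by rewrite mean_quadratic_top mulr_ge0_le0 ?mulr_ge0// sub0r oppr_le0 mulr_ge0// ltW.
- rewrite (_ : mean_quadratic _ _ _ _ =
      n%:R * p * (1 + (n%:R - 1) * p - k%:R)); last first.
    by rewrite /mean_quadratic; ring.
  by rewrite mulr_ge0 ?subr_ge0// mulr_ge0// ltW.
- move=> s sn; rewrite mulNr mulrC -/(_ / _) lerBrDr.
  have snR : s%:R <= n%:R :> R by rewrite ler_nat.
  case: leqP => ks.
    rewrite gerDl ler_pdivrMr ?mulr_gt0// mul0r.
    by rewrite mulr_ge0_le0 ?subr_ge0 ?subr_le0 ?ler_nat.
  rewrite add0r ler_pdivrMr ?mulr_gt0// mul1r.
  have skR : s%:R <= k%:R :> R by rewrite ler_nat ltnW.
  have s0 : 0 <= s%:R :> R by [].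
  nra.
- move=> s; rewrite !inE => /or3P[]/eqP->.
  + by rewrite touch0 leqn0 (gtn_eqF k1).
  + by rewrite leqnn subrr mul0r mulr0 addr0.
  + by rewrite (ltnW kn) subrr !mulr0 addr0.
Qed.

(** When n p < k, the two sign hypotheses say that i - 1 <= x <= i, where x is the
    zero of the affine function t |-> E[(S - t)(S - k)]; the ceiling of x is such
    an i.  The case i = 0 is excluded, since i - 1 must be a possible value
    of S. *)
Lemma Pbar_large_k (R : realType) n k (p : R) (i : nat) :
  (2 <= n)%N -> (1 <= i)%N -> (i < k)%N -> (k <= n)%N ->
  mean_quadratic n p (i%:R - 1) k%:R <= 0 -> 0 <= mean_quadratic n p i%:R k%:R ->
  tail_probabilities n k p (Pbar n k p) /\
  Pbar n k p = (mean_quadratic n p (i%:R - 1) i%:R /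
                ((k%:R - i%:R) ^+ 2 + (k%:R - i%:R)))%:E.
Proof.
move=> n2 i1 ik kn Glow Gup.
have ki0 : 0 < k%:R - i%:R :> R by rewrite subr_gt0 ltr_nat.
set D := _ ^+ 2 + _.
have D0 : 0 < D by rewrite addr_gt0// exprn_gt0.
have predE : i.-1%:R = i%:R - 1 :> R by rewrite -subn1 natrB.
have -> : mean_quadratic n p (i%:R - 1) i%:R / D =
    0 + D^-1 * mean_quadratic n p (i%:R - 1) i%:R by rewrite add0r mulrC.
apply: (@Pbar_quadratic _ _ _ _ _ _ _ _ i.-1 i k) => //.
- by rewrite prednK.
- by rewrite predE.
- by rewrite predE mean_quadratic_consecutive_ge0// i1 (leq_trans (ltnW ik)).
- move=> s sn; rewrite add0r mulrC -/(_ / _).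
  case: leqP => ks.
    rewrite ler_pdivlMr// mul1r /D.
    have : k%:R <= s%:R :> R by rewrite ler_nat.
    nra.
  rewrite divr_ge0 ?(ltW D0)//.
  case: (leqP i s) => si.
    have : i%:R <= s%:R :> R by rewrite ler_nat.
    by move=> ?; rewrite mulr_ge0// subr_ge0// lerBlDr ler_wpDr.
  have : s%:R <= i%:R - 1 :> R by rewrite -predE ler_nat; lia.
  move=> ?; rewrite mulr_le0// subr_le0//.
  by rewrite ler_nat ltnW.
- move=> s; rewrite !inE => /or3P[]/eqP->.
  + have -> : (k <= i.-1)%N = false by lia.
    by rewrite predE subrr mul0r mulr0 addr0.
  + have -> : (k <= i)%N = false by lia.
    by rewrite subrr !mulr0 addr0.
  + rewrite leqnn add0r (_ : (_ - _) * (_ - _) = D) ?mulVf ?gt_eqF//.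
    by rewrite /D; ring.
Qed.

Theorem theorem4p1 (R : realType) (n k : nat) (p : R)
    (hn : (2 <= n)%N) (hp : 0 < p < 1) (hk : (1 <= k <= n)%N) :
  tail_probabilities n k p (Pbar n k p) /\
  Pbar n k p =
    (if k%:R < (n%:R - 1) * p then 1
     else if k%:R < 1 + (n%:R - 1) * p then
       ((n%:R - 1) * (1 - p) + k%:R) * p / k%:R
     else
       let i : R :=
         (Num.ceil (n%:R * p * (k%:R - 1 - (n%:R - 1) * p)
                      / (k%:R - n%:R * p)))%:~R in
       ((i - 1) * (i - 2 * n%:R * p) + n%:R * (n%:R - 1) * p ^+ 2)
         / ((k%:R - i) ^+ 2 + (k%:R - i)))%:E.
Proof.
have /andP[p0 p1] := hp; have /andP[k1 kn] := hk.
case: ltrP => [|kge]; first exact: Pbar_small_k.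
case: ltrP => [klt|kge1].
  by apply: Pbar_middle_k => //; rewrite kge ltW.
have knp : 0 < k%:R - n%:R * p.
  rewrite subr_gt0; apply: lt_le_trans kge1.
  by rewrite mulrBl mul1r addrCA ltrDl subr_gt0.
have k0 : 0 < k%:R :> R by rewrite ltr0n.
have np0 : 0 < n%:R * p by rewrite mulr_gt0// ltr0n; lia.
(* The number x is the zero of the affine function t |-> E[(S - t)(S - k)]. *)
set x := _ / _.
have x0 : 0 <= x by rewrite divr_ge0 ?(ltW knp)// mulr_ge0 ?(ltW np0)//; lra.
have GE t : mean_quadratic n p t k%:R = (k%:R - n%:R * p) * (t - x).
  by rewrite /mean_quadratic /x; field; rewrite gt_eqF.
have xk : x <= k%:R - 1.
  by rewrite -subr_ge0 -(pmulr_rge0 _ knp) -GE mean_quadratic_consecutive_ge0.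
case: (Num.ceil x) (ceil_itv x) => [i|j]; last first.
  move=> /andP[_ /(le_trans x0)]; by rewrite ler0z.
rewrite -[(Posz i)%:~R]/(i%:R) intrB -[(Posz i)%:~R]/(i%:R) => /andP[xgt xle] /=.
have ik : (i < k)%N.
  by rewrite -(ltr_nat R); lra.
have -> : (i%:R - 1) * (i%:R - 2 * n%:R * p) + n%:R * (n%:R - 1) * p ^+ 2 =
    mean_quadratic n p (i%:R - 1) i%:R by rewrite /mean_quadratic; ring.
have [i0|i_gt0] := posnP i; last first.
  apply: Pbar_large_k => //; rewrite GE.
  - by rewrite mulr_ge0_le0 ?(ltW knp)// subr_le0 ltW.
  - by rewrite mulr_ge0 ?(ltW knp)// subr_ge0.
(* When i = 0 the point i - 1 is not available, but x = 0 puts k on the boundary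
   of the middle regime. *)
have xE : x = 0 by apply/le_anti; rewrite x0 (le_trans xle)// i0.
have kE : k%:R = 1 + (n%:R - 1) * p.
  have := GE 0; rewrite xE subrr mulr0 /mean_quadratic.
  have -> : n%:R * (n%:R - 1) * p ^+ 2 + (1 - 0 - k%:R) * (n%:R * p) + 0 * k%:R =
     n%:R * p * (1 + (n%:R - 1) * p - k%:R) by ring.
  by move/eqP; rewrite mulf_eq0 gt_eqF//= subr_eq0 => /eqP.
have [] := @Pbar_middle_k R n k p hn hp k1; first by rewrite kge kE lexx.
move=> attained PE; split=> //; rewrite PE; congr _%:E.
rewrite i0 /mean_quadratic !subr0 sub0r; apply/eqP.
rewrite eqr_div; last by rewrite gt_eqF// addr_gt0// exprn_gt0.
  by rewrite kE; apply/eqP; ring.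
by rewrite gt_eqF.
Qed.
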